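(* Let $(N,M,L)=(3,2,3)$ and fix a seam position $k\in\mathbb Z_3$. Let $H_{\rm Weyl}^\sigma=H_0^\sigma(2;k)$ and $H_{\rm VMY}^\sigma=H_{1-M}^\sigma(2;k)=H_{-1}^\sigma(2;k)$ be the $24\times24$ Hermitian operators defined in the context, and let $\nu_\eta=(-1)^{\eta-(1-M)}$. Then the label $\eta=0$ of $H_{\rm Weyl}^\sigma$ has $\nu=-1$ and the label $\eta=1-M$ of $H_{\rm VMY}^\sigma$ has $\nu=+1$. For arbitrary branches $\sigma,\tau\in\{+,-\}$, $H_{\rm Weyl}^{\sigma}$ is not unitarily equivalent to $H_{\rm VMY}^{\tau}$. The spectrum of $H_{\rm Weyl}^\sigma$ consists of exactly eight simple eigenvalues and eight eigenvalues of multiplicity two; the spectrum of $H_{\rm VMY}^\tau$ consists of exactly twelve eigenvalues of multiplicity two.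
   Context: Parameters: $N=3$, $M=2$, $\varepsilon=e^{i\pi/3}$, $q=\varepsilon^2=e^{2\pi i/3}$, $\omega=q^2$, $f_\eta=\varepsilon^\eta$ ($\eta\in\mathbb Z_{6}$). Endpoint space $\mathbb C^3_a$ with basis $|1\rangle,|2\rangle,|3\rangle$ (indices mod $3$): $Z|n\rangle=\omega^n|n\rangle$, $X|n\rangle=|n+1\rangle$; $Y_{m,n}=X^mZ^n$. A physical site is $\mathbb C^2$ with basis $|0\rangle,|1\rangle$; $\sigma^+=|0\rangle\langle1|$, $\sigma^-=|1\rangle\langle0|$, $\sigma^z=\operatorname{diag}(1,-1)$. Bond density: $h_{j,j+1}=q\sigma_j^+\sigma_{j+1}^-+q^{-1}\sigma_j^-\sigma_{j+1}^++\frac{q+q^{-1}}4\sigma_j^z\sigma_{j+1}^z$. In the two-spin basis $|0\rangle=|00\rangle,|1\rangle=|01\rangle,|2\rangle=|10\rangle,|3\rangle=|11\rangle$ with $E_{rc}=|r\rangle\langle c|$ (tensor signs omitted), operators on $\mathbb C^2_A\otimes\mathbb C^2_B\otimes\mathbb C^3_a$: $$\begin{aligned}S_+=\tfrac12\bigl[&-E_{01}Y_{-1,-1}+q^3E_{02}Y_{-1,0}-q^4E_{03}Y_{-2,-1}-q^2E_{10}Y_{1,1}+q^2E_{12}Y_{0,1}-qE_{13}Y_{-1,0}\\&+q^{-3}E_{20}Y_{1,0}+q^{-2}E_{21}Y_{0,-1}+q^2E_{23}Y_{-1,-1}-E_{30}Y_{2,1}-q^{-1}E_{31}Y_{1,0}+E_{32}Y_{1,1}\bigr],\\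 S_-=\tfrac12\bigl[&E_{01}Y_{-1,1}-qE_{02}Y_{-1,0}-E_{03}Y_{-2,1}+q^{-2}E_{10}Y_{1,-1}+q^2E_{12}Y_{0,-1}+q^3E_{13}Y_{-1,0}\\&-q^{-1}E_{20}Y_{1,0}+q^{-2}E_{21}Y_{0,1}-q^{-2}E_{23}Y_{-1,1}-q^{-4}E_{30}Y_{2,-1}+q^{-3}E_{31}Y_{1,0}-E_{32}Y_{1,-1}\bigr].\end{aligned}$$ Output-normalized seam: $F_+^{(\eta)}=\operatorname{diag}(1,f_\eta)$, $F_-^{(\eta)}=\operatorname{diag}(f_\eta,1)$, $S^{(\eta)}_{\sigma,ABa}=F^{(\eta)}_{\sigma,B}S_{\sigma,ABa}F^{(\eta)\dagger}_{\sigma,B}$ ($F$ on the second physical site $B$). Ring: $L=3$ sites labelled by $\mathbb Z_3$, Hilbert space $(\mathbb C^2)^{\otimes 3}\otimes\mathbb C^3_a$, $$H_\eta^\sigma(M;k)=\sum_{j\in\mathbb Z_3,\ j\ne k-1}h_{j,j+1}+S^{(\eta)}_{\sigma,k-1,k,a},$$ subscripts indicating the ordered tensor factors acted on. *)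

(* Defs.v *)
From HB Require Import structures.
From mathcomp Require Import all_boot all_order all_algebra.
From mathcomp Require Import reals trigo.
From mathcomp Require Import complex.
From mathcomp Require mxtens.

Set Implicit Arguments.
Unset Strict Implicit.
Unset Printing Implicit Defensive.

Import Order.TTheory GRing.Theory Num.Theory.
Local Open Scope ring_scope.
Local Open Scope complex_scope.
Local Open Scope sesquilinear_scope.

Local Notation "A *t B" := (mxtens.tensmx A B)
  (at level 40, left associativity).

(* Specialised to N = 3, M = 2, L = 3: the ring sites and the endpoint basis
   are labelled by 'Z_3, the labels eta by 'Z_(2 N) = 'Z_6. *)
Definition Mpar : nat := 2.

Inductive branch : Set := Plus | Minus.

(* The exponent is a representative in {0, ..., 5}; only its parity matters,
   and this is well defined modulo 6. *)
Definition nu (eta : 'Z_6) : int := (-1) ^+ ((eta - (1 - Mpar%:R))%R : 'Z_6).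

Section Operators.
Variable R : realType.

Local Notation C := R[i].

(* (C^2)^{(x) 3} (x) C^3_a, sites 0, 1, 2 from left to right, then the
   endpoint; matrices act on column vectors. *)
Local Notation operator := 'M[C]_(2 * 2 * 2 * 3).

(* exp (i pi / 3) *)
Definition eps : C := cos (pi / 3) +i* sin (pi / 3).
Definition q : C := eps ^+ 2.
Definition omega : C := q ^+ 2.
Definition f_phase (eta : 'Z_6) : C := eps ^+ eta.

(* The endpoint basis |1>, |2>, |3> is indexed modulo 3, so that |3> is the
   vector of index 0 : 'Z_3 (omega ^+ 3 = 1). *)
Definition Zmx : 'M[C]_3 := \matrix_(i, j) (omega ^+ i *+ (i == j)).
Definition Xmx : 'M[C]_3 := \matrix_(i < 3, j < 3) ((i == j + 1)%:R).
Definition Y (m n : int) : 'M[C]_3 := Xmx ^ m * Zmx ^ n.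

Definition at_site (j : 'Z_3) (A : 'M[C]_2) : operator :=
  (if j == 0 then A else 1%:M) *t (if j == 1 then A else 1%:M)
    *t (if j == 2 then A else 1%:M) *t (1%:M : 'M[C]_3).

Definition at_end (B : 'M[C]_3) : operator :=
  (1%:M : 'M[C]_2) *t (1%:M : 'M[C]_2) *t (1%:M : 'M[C]_2) *t B.

Definition sigma_p : 'M[C]_2 := delta_mx 0 1.
Definition sigma_m : 'M[C]_2 := delta_mx 1 0.
Definition sigma_z : 'M[C]_2 := delta_mx 0 0 - delta_mx 1 1.

Definition bond (j : 'Z_3) : operator :=
  q *: (at_site j sigma_p *m at_site (j + 1) sigma_m)
  + q^-1 *: (at_site j sigma_m *m at_site (j + 1) sigma_p)
  + ((q + q^-1) / 4) *: (at_site j sigma_z *m at_site (j + 1) sigma_z).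

(* E_{rc} Y_{m,n} on the sites A, B and the endpoint, where r, c < 4 stand for
   the two-spin states |0> = |00>, |1> = |01>, |2> = |10>, |3> = |11>:
   the spin at A is r %/ 2 and the spin at B is r %% 2. *)
Definition EY (A B : 'Z_3) (r c : nat) (m n : int) : operator :=
  at_site A (delta_mx (inZp (r %/ 2)) (inZp (c %/ 2)))
  *m at_site B (delta_mx (inZp (r %% 2)) (inZp (c %% 2)))
  *m at_end (Y m n).

Definition S_plus (A B : 'Z_3) : operator :=
  2^-1 *: (- EY A B 0 1 (-1) (-1)
           + q ^+ 3 *: EY A B 0 2 (-1) 0
           - q ^+ 4 *: EY A B 0 3 (-2) (-1)
           - q ^+ 2 *: EY A B 1 0 1 1
           + q ^+ 2 *: EY A B 1 2 0 1
           - q *: EY A B 1 3 (-1) 0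
           + q ^- 3 *: EY A B 2 0 1 0
           + q ^- 2 *: EY A B 2 1 0 (-1)
           + q ^+ 2 *: EY A B 2 3 (-1) (-1)
           - EY A B 3 0 2 1
           - q^-1 *: EY A B 3 1 1 0
           + EY A B 3 2 1 1).

Definition S_minus (A B : 'Z_3) : operator :=
  2^-1 *: (EY A B 0 1 (-1) 1
           - q *: EY A B 0 2 (-1) 0
           - EY A B 0 3 (-2) 1
           + q ^- 2 *: EY A B 1 0 1 (-1)
           + q ^+ 2 *: EY A B 1 2 0 (-1)
           + q ^+ 3 *: EY A B 1 3 (-1) 0
           - q^-1 *: EY A B 2 0 1 0
           + q ^- 2 *: EY A B 2 1 0 1
           - q ^- 2 *: EY A B 2 3 (-1) 1
           - q ^- 4 *: EY A B 3 0 2 (-1)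
           + q ^- 3 *: EY A B 3 1 1 0
           - EY A B 3 2 1 (-1)).

Definition S_branch (sigma : branch) : 'Z_3 -> 'Z_3 -> operator :=
  match sigma with Plus => S_plus | Minus => S_minus end.

Definition F_twist (sigma : branch) (eta : 'Z_6) : 'M[C]_2 :=
  match sigma with
  | Plus => delta_mx 0 0 + f_phase eta *: delta_mx 1 1
  | Minus => f_phase eta *: delta_mx 0 0 + delta_mx 1 1
  end.

Definition seam (sigma : branch) (eta : 'Z_6) (A B : 'Z_3) : operator :=
  at_site B (F_twist sigma eta) *m S_branch sigma A B *m at_site B ((F_twist sigma eta) ^t*).

Definition H_ring (sigma : branch) (eta : 'Z_6) (k : 'Z_3) : operator :=
  \sum_(j : 'Z_3 | j != k - 1) bond j + seam sigma eta (k - 1) k.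

Definition H_Weyl (sigma : branch) (k : 'Z_3) : operator := H_ring sigma 0 k.
Definition H_VMY (sigma : branch) (k : 'Z_3) : operator :=
  H_ring sigma (1 - Mpar%:R) k.

End Operators.

Definition unitarily_equivalent (C : numClosedFieldType) n (A B : 'M[C]_n) :=
  exists2 U : 'M[C]_n, U \is unitarymx & U *m A *m U ^t* = B.

Definition eigen_mult (C : numClosedFieldType) n (A : 'M[C]_n) (a : C) : nat :=
  \rank (eigenspace A a).

(* The distinct eigenvalues of A, listed in some order, have exactly the
   multiplicities ms, counted with repetition. Multiplicities are dimensions of
   eigenspaces; for Hermitian A these are also the algebraic ones. *)
Definition spectrum_multiplicities (C : numClosedFieldType) n (A : 'M[C]_n)
    (ms : seq nat) :=
  exists s : seq C, [/\ uniq s, forall a, (a \in s) = eigenvalue A a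
    & perm_eq [seq eigen_mult A a | a <- s] ms].

(* Main.v *)
(** The operators 8H have entries in Z[q], so everything about them can be
    computed exactly.  For a matrix A and a polynomial m with m(A) = 0 let G(x)
    be the quotient (m(A) - m(x)) / (A - x).  At a simple root x of m, G(x) is
    m'(x) times the projector onto the eigenspace of x, so tr G(x) is m'(x)
    times the multiplicity of x.  Taking m = a b squarefree, the identity
    tr G = a' b + 2 a b' says that the roots of a are simple eigenvalues and
    those of b double ones.  The roots of m are separated by sign changes at
    integer points.  Unitarily equivalent matrices have the same multiplicities,
    and only the Weyl seam has simple eigenvalues. *)
From Stdlib Require Import ZArith.
Require Import Defs.
From mathcomp Require Import all_boot all_order all_algebra.
From mathcomp Require Import reals trigo.
From mathcomp Require Import complex.
From mathcomp Require Import separable polyrcf mxtens ssrZ zify ring lra.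

Import Order.TTheory GRing.Theory Num.Theory.
Local Open Scope ring_scope.
Local Open Scope complex_scope.
Local Open Scope sesquilinear_scope.
Set Implicit Arguments.
Unset Strict Implicit.
Unset Printing Implicit Defensive.
Delimit Scope Z_scope with ZZ.
Local Arguments Defs.q : simpl never.

(** * Eigenvalue multiplicities from traces *)

Section Horner.
Variables (F : fieldType) (n : nat) (A : 'M[F]_n).
Implicit Types (s : seq F) (x : F).

(* The pair (m(A), G(x)), where m has the coefficients s. *)
Fixpoint horner_quo x s : 'M[F]_n * 'M[F]_n :=
  if s is c :: s' then
    let: (B, G) := horner_quo x s' in (A *m B + c%:M, x *: G + B)
  else (0, 0).

Lemma Poly_cons c s : Poly (c :: s) = Poly s * 'X + c%:P :> {poly F}.
Proof. by rewrite /= cons_poly_def. Qed.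

Lemma horner_quo_comm x s : comm_mx A (horner_quo x s).1.
Proof.
elim: s => [|c s] /=; first by rewrite /comm_mx mulmx0 mul0mx.
case: (horner_quo x s) => B G /= AB.
by rewrite /comm_mx mulmxDr mulmxDl -mulmxA -AB scalar_mxC.
Qed.

(** Induction on the Horner scheme: since [A] and [B] commute, (x G + B)(A - x) telescopes to A B -
    x p(x), where p is the polynomial of the tail. *)
Lemma horner_quoE x s :
  (horner_quo x s).2 *m (A - x%:M) = (horner_quo x s).1 - ((Poly s).[x])%:M.
Proof.
elim: s => [|c s]; first by rewrite /= horner0 mul0mx raddf0 subrr.
have:= horner_quo_comm x s; rewrite Poly_cons !hornerE /=.
case: (horner_quo x s) => B G /= AB IH.
rewrite mulmxDl -scalemxAl IH mulmxBr -AB mul_mx_scalar scalerBr.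
rewrite raddfD /= opprD [RHS]addrACA subrr addr0 scale_scalar_mx [x * _]mulrC.
by rewrite [LHS]addrC addrA subrK.
Qed.

(** On row vectors with [V *m A = x *: V] the matrix [A] acts as the scalar x, and the recursion for
    G becomes the Horner recursion for the derivative, (p X + c)' = p' X + p. *)
Lemma horner_quo_eigen x s m (V : 'M_(m, n)) :
  V *m A = x *: V ->
  V *m (horner_quo x s).1 = (Poly s).[x] *: V
  /\ V *m (horner_quo x s).2 = (Poly s)^`().[x] *: V.
Proof.
move=> VA; elim: s => [|c s].
  by rewrite /= !mulmx0 linear0 !horner0 !scale0r.
rewrite Poly_cons !derivE !hornerE /=; case: (horner_quo x s) => B G /= [VB VG].
rewrite mulmxDr mulmxA VA -scalemxAl VB mul_mx_scalar scalerA scalerDl mulrC.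
by split=> //; rewrite mulmxDr -scalemxAr VG VB scalerA scalerDl addrC mulrC.
Qed.

(** G annihilates A - x, so its rows lie in the eigenspace; it acts there as the nonzero scalar
    p'(x), so its row space is the whole eigenspace. Hence G is p'(x) times a projector, and the
    trace counts its rank. *)
Lemma mxtrace_horner_quo x s :
    (horner_quo x s).1 = 0 -> root (Poly s) x -> (Poly s)^`().[x] != 0 ->
  \tr (horner_quo x s).2 = (Poly s)^`().[x] *+ \rank (eigenspace A x).
Proof.
move=> B0 /rootP px0 dpx; have := horner_quoE x s.
set d := _.[x] in dpx *; set G := _.2; rewrite B0 px0 raddf0 subrr => GA0.
have GE : (G <= eigenspace A x)%MS by apply/sub_kermxP.
have EG : (eigenspace A x <= G)%MS.
  have/(horner_quo_eigen s)[_ VG] := eigenspaceP (submx_refl (eigenspace A x)).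
  by rewrite -(eqmx_scale _ dpx) -VG submxMl.
have -> : \rank (eigenspace A x) = \rank G.
  by apply/eqP; rewrite eqn_leq !mxrankS.
have UA : row_base G *m A = x *: row_base G.
  by apply/eigenspaceP; rewrite eq_row_base.
have [_ UG] := horner_quo_eigen s UA.
(* Full-rank factorization G = C V with C = [col_base G] and V = [row_base G]: from V C V = V G = d
   V and the row-freeness of V, V C is the scalar matrix d of size the rank of G. *)
have CU : row_base G *m col_base G = d%:M.
  apply: (row_free_inj (row_base_free G)).
  by rewrite -mulmxA mulmx_base UG mul_scalar_mx.
by rewrite -{1}(mulmx_base G) mxtrace_mulC CU mxtrace_scalar.
Qed.

End Horner.

(** The intermediate value theorem gives a root strictly inside each interval; the endpoints between
    them keep successive roots apart. *)
Lemma sign_change_roots (R : rcfType) (p : {poly R}) x0 xs :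
  path (fun x y => (x < y) && (p.[x] * p.[y] < 0)) x0 xs ->
  exists rs, [/\ size rs = size xs, path <%R x0 rs & all (root p) rs].
Proof.
elim: xs x0 => [|x xs IH] x0 /=; first by exists [::].
case/andP=> /andP[x0x /(poly_ivtoo (ltW x0x))[r]].
rewrite in_itv /= => /andP[x0r rx] pr /IH[rs [<- rs_x rts]].
exists (r :: rs); rewrite /= x0r pr; split=> //.
by case: rs rs_x {rts} => //= y rs /andP[xy ->]; rewrite (lt_trans rx).
Qed.

Section Spectrum.
Variables (C : numClosedFieldType) (n : nat).
Implicit Types (A : 'M[C]_n) (a b : {poly C}) (s rs : seq C).

(** With as many distinct roots as its degree, [a] is a constant times a product of distinct linear
    factors. It has no further root and is coprime to its derivative. *)
Lemma separable_root_deriv a rs x :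
    size a = (size rs).+1 -> uniq rs -> all (root a) rs -> root a x ->
  x \in rs /\ a^`().[x] != 0.
Proof.
move=> sz_a Urs rts ax; have a0 : a != 0 by rewrite -size_poly_gt0 sz_a.
have Da := all_roots_prod_XsubC sz_a rts; rewrite uniq_rootsE in Da.
have lc0 : lead_coef a != 0 by rewrite lead_coef_eq0.
split; first by move: ax; rewrite Da // rootZ ?root_prod_XsubC.
suff : separable_poly a by rewrite unlock => /coprimep_root/(_ ax).
by rewrite Da // (eqp_separable (eqp_scale _ lc0)) separable_prod_XsubC.
Qed.

Lemma spectrum_multiplicities_horner A s a b i j rs :
    Poly s = a * b -> size a = i.+1 -> size b = j.+1 -> size rs = (i + j)%N ->
    uniq rs -> all (root (a * b)) rs ->
    (forall x, (horner_quo A x s).1 = 0) ->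
    (forall x, \tr (horner_quo A x s).2 = (a^`() * b + (a * b^`()) *+ 2).[x]) ->
  spectrum_multiplicities A (nseq i 1%N ++ nseq j 2%N).
Proof.
move=> Ds sz_a sz_b sz_rs Urs rts B0 trG.
have a0 : a != 0 by rewrite -size_poly_gt0 sz_a.
have b0 : b != 0 by rewrite -size_poly_gt0 sz_b.
have sz_ab : size (a * b) = (size rs).+1.
  by rewrite size_mul // sz_a sz_b sz_rs addnS.
have rsP x : root (a * b) x -> x \in rs /\ (a * b)^`().[x] != 0.
  exact: separable_root_deriv.
(* The derivative of a b is a' b at a root of [a] and a b' at a root of [b], so the trace is once or
   twice this nonzero number; characteristic zero lets the multiplicity be read off. *)
have mult x : root (a * b) x -> eigen_mult A x = if root a x then 1%N else 2%N.
  move=> abx; have [_ dab] := rsP x abx.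
  have := trG x; rewrite hornerD hornerMn mxtrace_horner_quo ?Ds // -[RHS]mulr1n.
  move: abx dab; rewrite derivM hornerD !hornerM /eigen_mult.
  have [/rootP ax _|nax bx] := boolP (root a x).
    by rewrite ax !mul0r mul0rn addr0 => /mulrIn dab /dab.
  have /rootP-> : root b x by move: bx; rewrite rootM (negPf nax).
  by rewrite !mulr0 !add0r mulr1n => /mulrIn dab /dab.
exists rs; split=> // [x|].
  apply/idP/idP=> [/(allP rts)/mult | /eigenvalueP[v vA v0]].
    by rewrite /eigenvalue -mxrank_eq0 /eigen_mult => ->; case: ifP.
  have [+ _] := horner_quo_eigen s vA; rewrite (B0 x) mulmx0 => /esym/eqP.
  by rewrite scaler_eq0 (negPf v0) orbF Ds => /rsP[].
(* Degrees bound the number of roots of each factor, and the two bounds add up to the number of all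
   roots, so both are attained. *)
have sz_fa : (size (filter (root a) rs) <= i)%N.
  by rewrite -ltnS -sz_a max_poly_roots ?filter_all ?uniq_rootsE ?filter_uniq.
have sz_fb : (size (filter (predC (root a)) rs) <= j)%N.
  rewrite -ltnS -sz_b max_poly_roots ?uniq_rootsE ?filter_uniq //.
  apply/allP=> x; rewrite mem_filter => /andP[/= nax /(allP rts)].
  by rewrite rootM (negPf nax).
have sz_f : (size (filter (root a) rs) + size (filter (predC (root a)) rs) = i + j)%N.
  by rewrite !size_filter count_predC.
have sfa : size (filter (root a) rs) = i.
  by apply/eqP; rewrite eqn_leq sz_fa -(leq_add2r j) -sz_f leq_add2l.
have sfb : size (filter (predC (root a)) rs) = j.
  by apply/eqP; rewrite -(eqn_add2l i) -sz_f sfa.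
have pC := permEl (perm_filterC (root a) rs).
rewrite perm_sym in pC; apply: (perm_trans (perm_map (eigen_mult A) pC)).
rewrite map_cat.
have mapE k (t : seq C) : {in t, forall x, eigen_mult A x = k} ->
    [seq eigen_mult A x | x <- t] = nseq (size t) k.
  elim: t => //= x t IH tk; rewrite tk ?mem_head ?IH // => y yt.
  by rewrite tk // inE yt orbT.
rewrite (mapE 1%N) ?sfa ?(mapE 2%N) ?sfb // => x; rewrite mem_filter.
  by case/andP=> /= nax /(allP rts)/mult; rewrite (negPf nax).
by case/andP=> ax /(allP rts)/mult; rewrite ax.
Qed.

Lemma eigenspace_scale c A x :
  c != 0 -> (eigenspace (c *: A) (c * x) :=: eigenspace A x)%MS.
Proof.
move=> c0; rewrite /eigenspace -scale_scalar_mx -scalerBr.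
apply/eqmxP/andP; split; apply/sub_kermxP.
  have/sub_kermxP := submx_refl (kermx (c *: (A - x%:M))).
  by rewrite -scalemxAr => /eqP; rewrite scaler_eq0 (negPf c0) => /eqP.
by rewrite -scalemxAr mulmx_ker scaler0.
Qed.

(** Brings the result for the integral operator 8H back to H. *)
Lemma spectrum_multiplicities_scale c A ms :
  c != 0 -> spectrum_multiplicities (c *: A) ms -> spectrum_multiplicities A ms.
Proof.
move=> c0 [s [Us sP sms]]; exists [seq c^-1 * x | x <- s].
have inj : injective (fun x => c^-1 * x) by apply: mulfI; rewrite invr_eq0.
split; first by rewrite map_inj_uniq.
  move=> x; rewrite -{1}[x](mulKf c0) mem_map // sP.
  by rewrite /eigenvalue -!mxrank_eq0 eigenspace_scale.
rewrite -map_comp -(eq_map (f := eigen_mult (c *: A))) // => x /=.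
by rewrite /eigen_mult -[x in LHS](mulVKf c0) eigenspace_scale.
Qed.

(** Conjugation by U turns A - x into U (A - x) U^*, of the same rank. Inclusion of the
    multiplicities as sets suffices to tell the two seams apart. *)
Lemma unitarily_equivalent_spectrum A B ms ms' :
    unitarily_equivalent A B -> spectrum_multiplicities A ms ->
  spectrum_multiplicities B ms' -> {subset ms <= ms'}.
Proof.
case=> U UU <- [s [Us sP sms]] [s' [Us' sP' sms']] m.
rewrite -(perm_mem sms) -(perm_mem sms') => /mapP[x xs ->].
have UV : U \in unitmx by apply: unitarymx_unit.
have rk : eigen_mult (U *m A *m U^t*) x = eigen_mult A x.
  rewrite /eigen_mult /eigenspace !mxrank_ker; congr (_ - _)%N.
  have -> : U *m A *m U^t* - x%:M = U *m (A - x%:M) *m U^t*.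
    rewrite mulmxBr mulmxBl mul_mx_scalar -scalemxAl (unitarymxP UU).
    by rewrite scalemx1.
  rewrite mxrankMfree ?row_free_unit -?invmx_unitary ?unitmx_inv //.
  by rewrite eqmxMfull ?row_full_unit.
rewrite -rk; apply: map_f; rewrite sP'; move: xs; rewrite sP.
by move: rk; rewrite /eigenvalue -!mxrank_eq0 /eigen_mult => ->.
Qed.

End Spectrum.

(** * Matrices over Z[q] as lists *)

(* [(a, b)] stands for a + b q; the operations use q^2 = - 1 - q. *)
Definition eis := (Z * Z)%type.
Definition eis_of_Z (z : Z) : eis := (z, Z0).
Definition eis0 : eis := (Z0, Z0).
Definition eis1 : eis := (Z.one, Z0).
Definition eisq : eis := (Z0, Z.one).
(** The sixth root of unity satisfies ε = 1 + q. *)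
Definition eis_eps : eis := (Z.one, Z.one).
Definition eis_eq0 (x : eis) := Z.eqb x.1 Z0 && Z.eqb x.2 Z0.
Definition eis_add (x y : eis) : eis := (Z.add x.1 y.1, Z.add x.2 y.2).
Definition eis_opp (x : eis) : eis := (Z.opp x.1, Z.opp x.2).
Definition eis_mul (x y : eis) : eis :=
  let t := Z.mul x.2 y.2 in
  (Z.sub (Z.mul x.1 y.1) t, Z.sub (Z.add (Z.mul x.1 y.2) (Z.mul x.2 y.1)) t).
(** Complex conjugation sends q to q^2 = - 1 - q. *)
Definition eis_conj (x : eis) : eis := (Z.sub x.1 x.2, Z.opp x.2).
Definition eis_exp (x : eis) (n : nat) : eis := iter n (eis_mul x) eis1.

(** Missing entries count as zero, so the same operation serves matrix rows and coefficient lists of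
    different lengths. *)
Definition vadd : seq eis -> seq eis -> seq eis :=
  fix vadd u v := match u, v with
  | [::], _ => v
  | _, [::] => u
  | x :: u', y :: v' => eis_add x y :: vadd u' v'
  end.
Definition vscale (c : eis) (u : seq eis) := map (eis_mul c) u.
Definition vmulm (u : seq eis) (M : seq (seq eis)) : seq eis :=
  foldr (fun cr v => if eis_eq0 cr.1 then v else vadd (vscale cr.1 cr.2) v)
    [::] (zip u M).

Fixpoint pmul (u v : seq eis) : seq eis :=
  if u is c :: u' then vadd (vscale c v) (eis0 :: pmul u' v) else [::].
(** Product rule in Horner form, (c + X u)' = u + X u'. *)
Fixpoint pderiv (u : seq eis) : seq eis :=
  if u is _ :: u' then vadd u' (eis0 :: pderiv u') else [::].

Local Notation mat := (seq (seq eis)).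

Definition entry (l : mat) i j := nth eis0 (nth [::] l i) j.
Definition mkm m n (f : nat -> nat -> eis) : mat :=
  [seq [seq f i j | j <- iota 0 n] | i <- iota 0 m].
Definition addm (l l' : mat) : mat := [seq vadd x.1 x.2 | x <- zip l l'].
Definition scalem c (l : mat) : mat := map (vscale c) l.
Definition mulm (l l' : mat) : mat := [seq vmulm u l' | u <- l].
Definition scalarm n c : mat := mkm n n (fun i j => if i == j then c else eis0).
Definition deltam m n (i j : nat) : mat :=
  mkm m n (fun a b => if (a == i) && (b == j) then eis1 else eis0).
Definition tensm m n p q (l l' : mat) : mat :=
  mkm (m * p) (n * q) (fun i j =>
    eis_mul (entry l (i %/ p) (j %/ q)) (entry l' (i %% p) (j %% q))).
Definition adjm m n (l : mat) : mat := mkm n m (fun i j => eis_conj (entry l j i)).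
Definition tracem n (l : mat) : eis :=
  foldr (fun i x => eis_add (entry l i i) x) eis0 (iota 0 n).
Definition powm n (l : mat) k : mat := iter k (mulm l) (scalarm n eis1).

(** The trace of G(x) is a polynomial in x whose coefficients are the traces of the successive
    Horner values B. One run therefore treats every x at once. *)
Fixpoint horner_tracem n (l : mat) (s : seq eis) : mat * seq eis :=
  if s is c :: s' then
    let: (B, t) := horner_tracem n l s' in
    (addm (mulm l B) (scalarm n c), tracem n B :: t)
  else (scalarm n eis0, [::]).

(** * The ring operators as lists *)

Definition atm (j : 'Z_3) (l : mat) : mat :=
  tensm (2 * 2 * 2) (2 * 2 * 2) 3 3
    (tensm (2 * 2) (2 * 2) 2 2
      (tensm 2 2 2 2 (if j == 0 then l else scalarm 2 eis1)
         (if j == 1 then l else scalarm 2 eis1))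
      (if j == 2 then l else scalarm 2 eis1))
    (scalarm 3 eis1).

Definition atendm (l : mat) : mat :=
  tensm (2 * 2 * 2) (2 * 2 * 2) 3 3
    (tensm (2 * 2) (2 * 2) 2 2
      (tensm 2 2 2 2 (scalarm 2 eis1) (scalarm 2 eis1)) (scalarm 2 eis1)) l.

Definition Zm : mat := mkm 3 3 (fun i j => if i == j then eis_exp eisq (2 * i) else eis0).
Definition Xm : mat := mkm 3 3 (fun i j => if i == (j.+1 %% 3)%N then eis1 else eis0).
(** X and Z have order 3, so reducing the exponents modulo 3 removes negative powers. *)
Definition Ym (m n : int) : mat :=
  mulm (powm 3 Xm (absz (m %% 3)%Z)) (powm 3 Zm (absz (n %% 3)%Z)).

Definition sigma_pm : mat := deltam 2 2 0 1.
Definition sigma_mm : mat := deltam 2 2 1 0.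
Definition sigma_zm : mat :=
  addm (deltam 2 2 0 0) (scalem (eis_of_Z (-1)%ZZ) (deltam 2 2 1 1)).

(* From here on, [bondm], the S tables, [seamm] and [H_ringm] describe the
   operators scaled by 8, which clears the denominators and makes integer
   points separate the eigenvalues. *)
Definition bondm (j : 'Z_3) : mat :=
  addm (addm
    (scalem (eis_mul (eis_of_Z 8%ZZ) eisq) (mulm (atm j sigma_pm) (atm (j + 1) sigma_mm)))
    (scalem (eis_mul (eis_of_Z 8%ZZ) (eis_exp eisq 2))
       (mulm (atm j sigma_mm) (atm (j + 1) sigma_pm))))
    (scalem (eis_of_Z (-2)%ZZ) (mulm (atm j sigma_zm) (atm (j + 1) sigma_zm))).

Definition EYm (A B : 'Z_3) (r c : nat) (m n : int) : mat :=
  mulm (mulm (atm A (deltam 2 2 (inZp (r %/ 2) : 'I_2) (inZp (c %/ 2) : 'I_2)))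
             (atm B (deltam 2 2 (inZp (r %% 2) : 'I_2) (inZp (c %% 2) : 'I_2))))
       (atendm (Ym m n)).

(* (-1)^s q^k; as q^3 = 1, the S tables write q^-k as q^2k. *)
Definition qe (s : bool) (k : nat) : eis :=
  if s then eis_opp (eis_exp eisq k) else eis_exp eisq k.

Definition Sterm (A B : 'Z_3) (s : bool) (k r c : nat) (m n : int) : mat :=
  scalem (qe s k) (EYm A B r c m n).
Arguments Sterm A B s (k r c)%_N (m n)%_Z.

Definition S_plusm (A B : 'Z_3) : mat :=
  scalem (eis_of_Z 4%ZZ) (foldl addm (Sterm A B true 0 0 1 (-1) (-1))
    [:: Sterm A B false 3 0 2 (-1) 0;
        Sterm A B true 4 0 3 (-2) (-1);
        Sterm A B true 2 1 0 1 1;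
        Sterm A B false 2 1 2 0 1;
        Sterm A B true 1 1 3 (-1) 0;
        Sterm A B false 6 2 0 1 0;
        Sterm A B false 4 2 1 0 (-1);
        Sterm A B false 2 2 3 (-1) (-1);
        Sterm A B true 0 3 0 2 1;
        Sterm A B true 2 3 1 1 0;
        Sterm A B false 0 3 2 1 1]).

Definition S_minusm (A B : 'Z_3) : mat :=
  scalem (eis_of_Z 4%ZZ) (foldl addm (Sterm A B false 0 0 1 (-1) 1)
    [:: Sterm A B true 1 0 2 (-1) 0;
        Sterm A B true 0 0 3 (-2) 1;
        Sterm A B false 4 1 0 1 (-1);
        Sterm A B false 2 1 2 0 (-1);
        Sterm A B false 3 1 3 (-1) 0;
        Sterm A B true 2 2 0 1 0;
        Sterm A B false 4 2 1 0 1;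
        Sterm A B true 4 2 3 (-1) 1;
        Sterm A B true 8 3 0 2 (-1);
        Sterm A B false 6 3 1 1 0;
        Sterm A B true 0 3 2 1 (-1)]).

Definition S_branchm (sigma : branch) : 'Z_3 -> 'Z_3 -> mat :=
  match sigma with Plus => S_plusm | Minus => S_minusm end.

Definition F_twistm (sigma : branch) (eta : 'Z_6) : mat :=
  let f := eis_exp eis_eps eta in
  match sigma with
  | Plus => addm (deltam 2 2 0 0) (scalem f (deltam 2 2 1 1))
  | Minus => addm (scalem f (deltam 2 2 0 0)) (deltam 2 2 1 1)
  end.

Definition seamm (sigma : branch) (eta : 'Z_6) (A B : 'Z_3) : mat :=
  mulm (mulm (atm B (F_twistm sigma eta)) (S_branchm sigma A B))
    (atm B (adjm 2 2 (F_twistm sigma eta))).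

Definition H_ringm (sigma : branch) (eta : 'Z_6) (k : 'Z_3) : mat :=
  addm
    (foldr (fun j l => if j != k - 1 then addm (bondm j) l else l) (scalarm 24 eis0)
      [:: 0; 1; 2 : 'Z_3])
    (seamm sigma eta (k - 1) k).

(** * Certificates for the spectra *)

Definition horner_Z (s : seq Z) (x : Z) : Z :=
  foldr (fun c y => Z.add c (Z.mul x y)) Z0 s.

(** Supplies the hypotheses of [spectrum_multiplicities_horner] for m = a b: annihilation, the trace
    identity compared coefficientwise, and sign changes. Leading coefficients 1 fix the degrees, so
    the last conjunct asks for as many intervals as the degree of m. *)
Definition spectrum_check n (l : mat) (a b : seq Z) x0 xs : bool :=
  let a' := map eis_of_Z a in
  let b' := map eis_of_Z b in
  let: (B, t) := horner_tracem n l (pmul a' b') in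
  let t' := vadd (pmul (pderiv a') b') (vscale (eis_of_Z 2%ZZ) (pmul a' (pderiv b'))) in
  let p x := Z.mul (horner_Z a x) (horner_Z b x) in
  [&& all (all eis_eq0) B,
      all eis_eq0 (vadd t (vscale (eis_of_Z (-1)%ZZ) t')),
      path (fun x y => Z.ltb x y && Z.ltb (Z.mul (p x) (p y)) Z0) x0 xs,
      Z.eqb (last Z0 a) Z.one, Z.eqb (last Z0 b) Z.one &
      size xs == ((size a).-1 + (size b).-1)%N].

Definition hermitian_check n (l : mat) : bool :=
  all (all eis_eq0) (addm l (scalem (eis_of_Z (-1)%ZZ) (adjm n n l))).

(* Coefficients, constant term first: the characteristic polynomials of 8 H_Weyl
   and 8 H_VMY are Weyl_a Weyl_b^2 and VMY_b^2 on both branches and for all k. *)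
Definition Weyl_a : seq Z :=
  [:: 25755648; -3932160; -2121728; 147456; 56064; -1024; -480; 0; 1]%ZZ.
Definition Weyl_b : seq Z :=
  [:: -2555904; -2162688; 335872; 405504; 56064; -1792; -480; 0; 1]%ZZ.
Definition VMY_b : seq Z :=
  [:: -7700742144; -6492782592; 3727687680; 2468347904; 71958528;
      -117374976; -13209600; 1032192; 170496; -2304; -720; 0; 1]%ZZ.
(** With the starting points -17 and -16 supplied in [check], these lists isolate the 16 roots of
    [Weyl_a] times [Weyl_b] and the 12 roots of [VMY_b]. *)
Definition Weyl_sep : seq Z :=
  [:: -16; -13; -9; -8; -7; -6; -5; -3; 0; 3; 5; 8; 12; 17; 19; 21]%ZZ.
Definition VMY_sep : seq Z :=
  [:: -14; -11; -8; -6; -5; -2; 0; 3; 8; 15; 18; 21]%ZZ.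

Definition check (sigma : branch) (k : 'Z_3) : bool :=
  let W := H_ringm sigma 0 k in
  let V := H_ringm sigma (1 - Mpar%:R) k in
  [&& hermitian_check 24 W, hermitian_check 24 V,
    spectrum_check 24 W Weyl_a Weyl_b (-17)%ZZ Weyl_sep &
    spectrum_check 24 V [:: 1%ZZ] VMY_b (-16)%ZZ VMY_sep].

(** Exact integer computation for each of the two branches and three seam positions. *)
Lemma check_all sigma k : check sigma k.
Proof.
have /allP : all (check sigma) [:: 0; 1; 2] by case: sigma; vm_compute.
by apply; case: k => [[|[|[|]]]].
Qed.

(** * Correctness of the list model *)

Section Representation.
Variable R : realType.
Local Notation C := R[i].
Local Notation q := (q R).

(** The target ring is arbitrary because integers are read both in [R], where roots are separated,
    and in [C], where the matrices live. *)
Definition zr (F : pzRingType) (z : Z) : F := (int_of_Z z)%:~R.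

Lemma zrD (F : pzRingType) x y : zr F (Z.add x y) = zr F x + zr F y.
Proof. by rewrite /zr -intrD; congr (_ %:~R); exact: rmorphD. Qed.
Lemma zrN (F : pzRingType) x : zr F (Z.opp x) = - zr F x.
Proof. by rewrite /zr -rmorphN; congr (_ %:~R); exact: rmorphN. Qed.
Lemma zrB (F : pzRingType) x y : zr F (Z.sub x y) = zr F x - zr F y.
Proof. by rewrite -Z.add_opp_r zrD zrN. Qed.
Lemma zrM (F : pzRingType) x y : zr F (Z.mul x y) = zr F x * zr F y.
Proof. by rewrite /zr -intrM; congr (_ %:~R); exact: rmorphM. Qed.
Lemma zr_lt (F : numDomainType) x y : Z.ltb x y -> zr F x < zr F y.
Proof. by move=> xy; rewrite /zr ltr_int; lia. Qed.

(** The addition formulas applied to π = π/3 + π/3 + π/3 identify the two parts of the cube with cos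
    π and sin π. *)
Lemma eps_cube : eps R ^+ 3 = - 1.
Proof.
have p3 : (pi : R) = pi / 3 + (pi / 3 + pi / 3) by field.
have := sinpi R; have := cospi R; rewrite {1 2}p3 !(cosD, sinD) => Dcos Dsin.
rewrite /eps !exprS expr0 mulr1; simpc.
by apply/eqP; rewrite eq_complex /=; apply/andP; split; apply/eqP;
  [rewrite -Dcos | rewrite -Dsin]; ring.
Qed.

Lemma eps_neqN1 : eps R + 1 != 0.
Proof.
apply/eqP => /(congr1 (@complex.Im R))/=/eqP; rewrite addr0 gt_eqF //.
by apply: sin_gt0_pi; have := pi_gt0 R; lra.
Qed.

(** Factor ε^3 + 1 = (ε + 1)(ε^2 - ε + 1); the first factor is nonzero because sin(π/3) > 0. *)
Lemma eps_root : eps R ^+ 2 = eps R - 1.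
Proof.
have := eps_neqN1; have : (eps R + 1) * (eps R ^+ 2 - eps R + 1) = 0.
  by rewrite -[RHS](subrr (eps R ^+ 3)) {2}eps_cube; ring.
move/eqP; rewrite mulf_eq0 orbC => /orP[/eqP e _|-> //].
by apply/subr0_eq; rewrite -e; ring.
Qed.

Lemma epsE : eps R = 1 + q.
Proof. by rewrite /Defs.q eps_root; ring. Qed.

Lemma q_root : q ^+ 2 = - 1 - q.
Proof.
have /eqP := eps_root; rewrite -subr_eq0 epsE => /eqP e.
by apply/subr0_eq; rewrite -e; ring.
Qed.

(** Both sides are inverse to q: the left because ε has modulus 1, the right by the quadratic
    equation of q. *)
Lemma conj_q : q^*%C = - 1 - q.
Proof.
have q0 : q != 0.
  apply/eqP=> q0; have := q_root; rewrite q0 => /eqP.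
  by rewrite expr0n /= subr0 eq_sym oppr_eq0 oner_eq0.
apply: (mulIf q0); rewrite mulrBl -expr2 q_root mulN1r opprB addKr opprK.
rewrite /Defs.q rmorphXn -exprMn.
have -> : (eps R)^*%C * eps R = 1.
  by rewrite /eps; simpc; rewrite -!expr2 cos2Dsin2 [sin _ * _]mulrC subrr.
by rewrite expr1n.
Qed.

Definition phi (x : eis) : C := zr C x.1 + zr C x.2 * q.

Lemma phi0 : phi eis0 = 0. Proof. by rewrite /phi mul0r addr0. Qed.
Lemma phi1 : phi eis1 = 1. Proof. by rewrite /phi mul0r addr0. Qed.
Lemma phiq : phi eisq = q. Proof. by rewrite /phi add0r mul1r. Qed.
Lemma phi_eps : phi eis_eps = eps R. Proof. by rewrite /phi epsE mul1r. Qed.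
Lemma phi_add x y : phi (eis_add x y) = phi x + phi y.
Proof. by rewrite /phi /= !zrD mulrDl addrACA. Qed.
Lemma phi_opp x : phi (eis_opp x) = - phi x.
Proof. by rewrite /phi /= !zrN mulNr opprD. Qed.
Lemma phi_mul x y : phi (eis_mul x y) = phi x * phi y.
Proof.
have /eqP := q_root; rewrite -subr_eq0 => /eqP q2.
apply/subr0_eq; rewrite /phi /= !zrB zrD !zrM.
(* The two sides differ by a multiple of q^2 + q + 1, with cofactor minus the product of the
   q-coefficients. *)
rewrite -[RHS](mulr0 (- zr C x.2 * zr C y.2)) -q2; ring.
Qed.
Lemma phi_exp x n : phi (eis_exp x n) = phi x ^+ n.
Proof. by elim: n => [|n IH]; rewrite ?phi1 //= phi_mul IH exprS. Qed.
Lemma phi_conj x : phi (eis_conj x) = (phi x)^*%C.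
Proof.
have zr_conj z : (zr C z)^*%C = zr C z by exact: rmorph_int.
have conjD (a b : C) : (a + b)^*%C = a^*%C + b^*%C by exact: rmorphD.
have conjM (a b : C) : (a * b)^*%C = a^*%C * b^*%C by exact: rmorphM.
by rewrite /phi conjD conjM !zr_conj conj_q zrB zrN; ring.
Qed.
Lemma eis_eq0P x : eis_eq0 x -> phi x = 0.
Proof.
by case: x => a b /andP[/Z.eqb_eq /= -> /Z.eqb_eq /= ->]; exact: phi0.
Qed.

(** * Vectors and matrices represented by lists *)

Lemma phi_nth u j : phi (nth eis0 u j) = (map phi u)`_j.
Proof.
have [ju|uj] := ltnP j (size u); first by rewrite (nth_map eis0).
by rewrite !nth_default ?size_map // phi0.
Qed.

Lemma phi_vadd u v j :
  phi (nth eis0 (vadd u v) j) = phi (nth eis0 u j) + phi (nth eis0 v j).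
Proof.
elim: u v j => [|x u IH] v j; first by rewrite nth_nil phi0 add0r.
by case: v => [|y v]; case: j => [|j]; rewrite /= ?phi_add ?IH // phi0 addr0.
Qed.

Lemma phi_vscale c u j :
  phi (nth eis0 (vscale c u) j) = phi c * phi (nth eis0 u j).
Proof.
have [ju|uj] := ltnP j (size u); first by rewrite (nth_map eis0) ?phi_mul.
by rewrite !nth_default ?size_map // phi0 mulr0.
Qed.

Lemma phi_vmulm u M n j : size M = n ->
  phi (nth eis0 (vmulm u M) j) = \sum_(k < n) phi (nth eis0 u k) * phi (entry M k j).
Proof.
move=> <-; rewrite /vmulm; elim: M u => [|r M IH] [|c u] /=.
- by rewrite big_ord0 nth_nil phi0.
- by rewrite big_ord0 nth_nil phi0.
- by rewrite nth_nil phi0 big1 // => k _; rewrite nth_nil phi0 mul0r.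
rewrite big_ord_recl /entry /= -IH; case: ifP => [/eis_eq0P->|_].
  by rewrite mul0r add0r.
by rewrite phi_vadd phi_vscale.
Qed.

(** The number of rows is fixed so that zipping loses none; row lengths stay free, since absent
    entries read as zero. *)
Definition rep m n (M : 'M[C]_(m, n)) (l : mat) :=
  size l = m /\ forall i j, M i j = phi (entry l i j).

Lemma rep_eq m n (M M' : 'M_(m, n)) l : rep M l -> rep M' l -> M = M'.
Proof. by move=> [_ Ml] [_ Ml']; apply/matrixP => i j; rewrite Ml Ml'. Qed.

Lemma entry_mkm m n f i j : (i < m)%N -> (j < n)%N -> entry (mkm m n f) i j = f i j.
Proof.
move=> im jn; rewrite /entry (nth_map 0) ?size_iota // (nth_map 0) ?size_iota //.
by rewrite !nth_iota.
Qed.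

Lemma rep_mkm m n (M : 'M_(m, n)) (f : nat -> nat -> eis) :
  (forall i j, M i j = phi (f i j)) -> rep M (mkm m n f).
Proof.
by move=> Mf; split=> [|i j]; rewrite ?size_map ?size_iota // entry_mkm.
Qed.

Lemma rep_add m n (M M' : 'M_(m, n)) l l' :
  rep M l -> rep M' l' -> rep (M + M') (addm l l').
Proof.
move=> [sl Ml] [sl' Ml']; split=> [|i j].
  by rewrite size_map size_zip sl sl' minnn.
rewrite mxE Ml Ml' /entry (nth_map ([::], [::])) ?size_zip ?sl ?sl' ?minnn //.
by rewrite nth_zip ?sl //= phi_vadd.
Qed.

Lemma rep_scale m n c c' (M : 'M_(m, n)) l :
  c = phi c' -> rep M l -> rep (c *: M) (scalem c' l).
Proof.
move=> -> [sl Ml]; split=> [|i j]; rewrite ?size_map //.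
by rewrite mxE Ml /entry (nth_map [::]) ?sl // phi_vscale.
Qed.

Lemma rep_mul m n p (M : 'M_(m, n)) (M' : 'M_(n, p)) l l' :
  rep M l -> rep M' l' -> rep (M *m M') (mulm l l').
Proof.
move=> [sl Ml] [sl' Ml']; split=> [|i j]; rewrite ?size_map //.
rewrite mxE /entry (nth_map [::]) ?sl // (phi_vmulm _ _ sl').
by apply: eq_bigr => k _; rewrite Ml Ml'.
Qed.

Lemma rep_scalar n c c' : c = phi c' -> rep (c%:M : 'M_n) (scalarm n c').
Proof.
move=> ->; apply: rep_mkm => i j; rewrite mxE -(inj_eq val_inj).
by case: eqP; rewrite ?phi0.
Qed.

Lemma rep_id n : rep (1%:M : 'M_n) (scalarm n eis1).
Proof. by apply: rep_scalar; rewrite phi1. Qed.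

Lemma rep_delta m n i j : rep (delta_mx i j : 'M_(m, n)) (deltam m n i j).
Proof.
by apply: rep_mkm => a b; rewrite mxE -!(inj_eq val_inj); case: ifP; rewrite ?phi0 ?phi1.
Qed.

Lemma rep_tens m n p r (M : 'M_(m, n)) (M' : 'M_(p, r)) l l' :
  rep M l -> rep M' l' -> rep (M *t M') (tensm m n p r l l').
Proof. by move=> [_ Ml] [_ Ml']; apply: rep_mkm => i j; rewrite mxE phi_mul Ml Ml'. Qed.

Lemma rep_adj m n (M : 'M_(m, n)) l : rep M l -> rep (M^t*) (adjm m n l).
Proof. by move=> [_ Ml]; apply: rep_mkm => i j; rewrite !mxE phi_conj Ml. Qed.

Lemma rep_pow n (M : 'M_n.+1) l k : rep M l -> rep (M ^+ k) (powm n.+1 l k).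
Proof.
move=> Ml; elim: k => [|k IH]; first exact: rep_id.
by rewrite exprS; apply: rep_mul.
Qed.

Lemma phi_tracem n (M : 'M_n) l : rep M l -> phi (tracem n l) = \tr M.
Proof.
move=> [_ Ml]; rewrite /mxtrace (eq_bigr _ (fun i _ => Ml i i)).
rewrite -(big_mkord xpredT (fun i => phi (entry l i i))) /index_iota subn0 /tracem.
elim: (iota 0 n) => [|i s IH] /=; first by rewrite big_nil phi0.
by rewrite phi_add IH big_cons.
Qed.

(** * Polynomials represented by coefficient lists *)

Lemma Poly_vadd u v :
  Poly (map phi (vadd u v)) = Poly (map phi u) + Poly (map phi v).
Proof. by apply/polyP => j; rewrite coefD !coef_Poly -!phi_nth phi_vadd. Qed.

Lemma Poly_vscale c u : Poly (map phi (vscale c u)) = phi c *: Poly (map phi u).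
Proof. by apply/polyP => j; rewrite coefZ !coef_Poly -!phi_nth phi_vscale. Qed.

Lemma Poly_pmul u v :
  Poly (map phi (pmul u v)) = Poly (map phi u) * Poly (map phi v).
Proof.
elim: u => [|c u IH]; first by rewrite /= mul0r.
rewrite [pmul _ _]/= Poly_vadd Poly_vscale !map_cons !Poly_cons IH phi0.
by rewrite mulrDl mul_polyC addr0 addrC mulrAC.
Qed.

Lemma Poly_pderiv u : Poly (map phi (pderiv u)) = (Poly (map phi u))^`().
Proof.
elim: u => [|c u IH]; first by rewrite /= deriv0.
rewrite [pderiv _]/= Poly_vadd !map_cons !Poly_cons IH phi0 !derivE.
by rewrite addr0.
Qed.

Lemma horner_tracemP n (A : 'M_n) l s x : rep A l ->
  let: (B, t) := horner_tracem n l s in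
  rep (horner_quo A x (map phi s)).1 B
  /\ \tr (horner_quo A x (map phi s)).2 = (Poly (map phi t)).[x].
Proof.
move=> Al; elim: s => [|c s] /=.
  rewrite mxtrace0 horner0; split=> //; rewrite -(raddf0 (@scalar_mx C n)).
  by apply: rep_scalar; rewrite phi0.
case: (horner_tracem n l s) => B t; case: (horner_quo _ _ _) => B' G /= [BB' tG].
split; first exact: rep_add (rep_mul Al BB') (rep_scalar _ erefl).
by rewrite mxtraceD mxtraceZ tG (phi_tracem BB') horner_cons mulrC.
Qed.

(** * Powers of q and the ring operators *)

Lemma phi_Z z : phi (eis_of_Z z) = zr C z.
Proof. by rewrite /phi mul0r addr0. Qed.

Lemma q_cube : q ^+ 3 = 1.
Proof.
have /eqP := q_root; rewrite -subr_eq0 => /eqP e; apply/subr0_eq.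
by rewrite -[RHS](mulr0 (q - 1)) -e; ring.
Qed.

Lemma qX_neq0 k : q ^+ k != 0.
Proof.
rewrite expf_neq0 //; apply/eqP=> q0; have/eqP := q_cube.
by rewrite q0 expr0n eq_sym oner_eq0.
Qed.

Lemma q_expN k : q ^- k = q ^+ (2 * k).
Proof.
apply: (mulfI (qX_neq0 k)); rewrite mulfV ?qX_neq0 // -exprD.
by rewrite -mulSn exprM q_cube expr1n.
Qed.

Lemma q_inv : q^-1 = q ^+ 2.
Proof. exact: (q_expN 1). Qed.

Lemma rep_at_site j A l : rep A l -> rep (at_site (R := R) j A) (atm j l).
Proof.
move=> Al; rewrite /at_site /atm; do 3?[apply: rep_tens]; last exact: rep_id.
all: by case: ifP => _ //; apply: rep_id.
Qed.

Lemma rep_at_end A l : rep A l -> rep (at_end (R := R) A) (atendm l).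
Proof. by move=> Al; do 3?[apply: rep_tens] => //; apply: rep_id. Qed.

Lemma rep_Z : rep (Zmx R) Zm.
Proof.
apply: rep_mkm => i j; rewrite mxE -(inj_eq val_inj) /omega -exprM.
by case: eqP; rewrite ?mulr0n ?phi0 // phi_exp phiq.
Qed.

Lemma rep_X : rep (Xmx R) Xm.
Proof.
apply: rep_mkm => i j; rewrite mxE -(inj_eq val_inj).
have -> : val (j + 1) = (j.+1 %% 3)%N by case: j => [[|[|[|]]]].
by case: eqP; rewrite ?phi0 ?phi1.
Qed.

(** The list computation gives M^3 = 1, so M is invertible and its integer powers depend only on the
    exponent modulo 3. *)
Lemma rep_expz3 (M : 'M[C]_3) l (k : int) :
    rep M l -> powm 3 l 3 = scalarm 3 eis1 ->
  rep (exprz M k) (powm 3 l (absz (k %% 3)%Z)).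
Proof.
move=> Ml l3; have M3 : M ^+ 3 = 1.
  by apply: (rep_eq (rep_pow 3 Ml)); rewrite l3; apply: rep_id.
have Mu : M \is a GRing.unit by rewrite -(unitrX_pos _ (isT : 0 < 3)%N) M3 unitr1.
have -> : exprz M k = M ^+ (absz (k %% 3)%Z).
  rewrite [RHS]exprnP gez0_abs ?modz_ge0 //.
  by rewrite {1}(divz_eq k 3) exprzDr // mulrC -exprz_exp -[exprz M 3]exprnP M3 exp1rz mul1r.
exact: rep_pow.
Qed.

Lemma rep_Y m n : rep (Y R m n) (Ym m n).
Proof.
apply: rep_mul; apply: rep_expz3; by [apply: rep_X | apply: rep_Z | vm_compute].
Qed.

Lemma rep_EY A B r c m n : rep (EY R A B r c m n) (EYm A B r c m n).
Proof.
apply: rep_mul; last exact/rep_at_end/rep_Y.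
by apply: rep_mul; apply/rep_at_site/rep_delta.
Qed.

Lemma phi_qe (s : bool) k : phi (qe s k) = (-1) ^+ s * q ^+ k.
Proof.
by rewrite /qe; case: s; rewrite ?phi_opp phi_exp phiq ?mulN1r ?mul1r.
Qed.

Lemma rep_Sterm A B (s : bool) k (c : C) r c' m n :
  c = (-1) ^+ s * q ^+ k -> rep (c *: EY R A B r c' m n) (Sterm A B s k r c' m n).
Proof. by move=> ->; apply: rep_scale; [rewrite phi_qe | apply: rep_EY]. Qed.

Lemma rep_S sigma A B : rep (8 *: S_branch R sigma A B) (S_branchm sigma A B).
Proof.
have e1 X : X = 1 *: X :> 'M[C]_(2 * 2 * 2 * 3) by rewrite scale1r.
case: sigma; rewrite /= /S_plus /S_minus scalerA; apply: rep_scale.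
1,3: by rewrite phi_Z -[zr _ _]/(4%:R); field.
all: rewrite /=; do ! [apply: rep_add].
(* Signs are absorbed into the scalars and bare terms get the coefficient 1, so that every summand
   has the shape of [rep_Sterm]. *)
all: rewrite -?scaleNr [X in rep X _]e1 ?scalerA ?scalerN -?scaleNr.
all: apply: rep_Sterm; rewrite ?q_inv ?q_expN ?mul1r ?mulN1r ?expr0 ?expr1 //.
Qed.

Lemma rep_sigma_z : rep (sigma_z R) sigma_zm.
Proof.
rewrite /sigma_z -scaleN1r; apply: rep_add; first exact: rep_delta.
by apply: rep_scale; [rewrite phi_Z | apply: rep_delta].
Qed.

Lemma rep_bond j : rep (8 *: bond R j) (bondm j).
Proof.
(* Here q + q^-1 = -1. *)
have h1 : 8 * ((q + q^-1) / 4) = - 2.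
  by rewrite q_inv q_root; field.
rewrite /bond !scalerDr !scalerA h1; do 2?apply: rep_add; apply: rep_scale.
- by rewrite phi_mul phi_Z phiq.
- by apply: rep_mul; apply/rep_at_site/rep_delta.
- by rewrite phi_mul phi_Z phi_exp phiq q_inv.
- by apply: rep_mul; apply/rep_at_site/rep_delta.
- by rewrite phi_Z.
- by apply: rep_mul; apply/rep_at_site/rep_sigma_z.
Qed.

Lemma rep_F_twist sigma eta : rep (F_twist R sigma eta) (F_twistm sigma eta).
Proof.
case: sigma; apply: rep_add; do ?[apply: rep_scale]; try exact: rep_delta.
all: by rewrite phi_exp phi_eps.
Qed.

Lemma rep_seam sigma eta A B : rep (8 *: seam R sigma eta A B) (seamm sigma eta A B).
Proof.
rewrite /seam scalemxAl scalemxAr; apply: rep_mul.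
  by apply: rep_mul; [apply/rep_at_site/rep_F_twist | apply: rep_S].
exact/rep_at_site/rep_adj/rep_F_twist.
Qed.

Lemma rep_H_ring sigma eta k : rep (8 *: H_ring R sigma eta k) (H_ringm sigma eta k).
Proof.
rewrite /H_ring scalerDr; apply: rep_add; last exact: rep_seam.
rewrite (perm_big [:: 0; 1; 2]); last first.
  apply: uniq_perm => [|//|j]; rewrite ?index_enum_uniq // mem_index_enum.
  by case: j => [[|[|[|]]]].
elim: [:: 0; 1; 2] => [|j s IH].
  by rewrite big_nil scaler0 -(raddf0 (@scalar_mx C _)); apply: rep_scalar; rewrite phi0.
rewrite big_cons /=; case: ifP => // _.
by rewrite scalerDr; apply: rep_add; first exact: rep_bond.
Qed.

(** * Soundness of the certificates *)

Lemma rep_zero m n (M : 'M[C]_(m, n)) l : rep M l -> all (all eis_eq0) l -> M = 0.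
Proof.
move=> [_ Ml] /(all_nthP [::]) l0; apply/matrixP=> i j; rewrite mxE Ml /entry.
have [il|il] := ltnP i (size l); last by rewrite (nth_default _ il) nth_nil phi0.
have [jl|jl] := ltnP j (size (nth [::] l i)); last by rewrite nth_default // phi0.
by apply: eis_eq0P; apply: (all_nthP _ (l0 _ il)).
Qed.

Lemma Poly_zero u : all eis_eq0 u -> Poly (map phi u) = 0.
Proof.
elim: u => //= x u IH /andP[x0 u0].
by rewrite IH // cons_poly_def mul0r add0r (eis_eq0P x0).
Qed.

Lemma hermitian_checkP n (A : 'M[C]_n) l :
  rep A l -> hermitian_check n l -> A \is hermsymmx.
Proof.
move=> Al; move/(rep_zero (rep_add Al (rep_scale (erefl _) (rep_adj Al)))).
rewrite phi_Z scaleN1r => /subr0_eq AE.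
by rewrite is_hermitianmxE expr0 scale1r {1}AE.
Qed.

Lemma horner_ZE (s : seq Z) (x : Z) :
  (Poly (map (zr R) s)).[zr R x] = zr R (horner_Z s x).
Proof.
elim: s => [|c s IH]; first by rewrite horner0.
by rewrite map_cons Poly_cons !hornerE IH /= zrD zrM addrC mulrC.
Qed.

(** Links the real polynomial, whose signs are tested, to the complex one evaluated at the
    matrix. *)
Lemma map_Poly_zr (s : seq Z) :
  map_poly (real_complex R) (Poly (map (zr R) s)) = Poly (map phi (map eis_of_Z s)).
Proof.
apply/polyP=> i; rewrite coef_map !coef_Poly.
have [iu|iu] := ltnP i (size s); last by rewrite !nth_default ?size_map // rmorph0.
rewrite (nth_map Z0) // -map_comp (nth_map Z0) //= phi_Z /zr.
exact: rmorph_int.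
Qed.

Lemma size_Poly_zr (s : seq Z) :
  Z.eqb (last Z0 s) Z.one -> size (Poly (map (zr R) s)) = (size s).-1.+1.
Proof.
case/lastP: s => // s x; rewrite last_rcons => /Z.eqb_eq ->.
by rewrite (PolyK (c := 0)) map_rcons ?last_rcons ?size_rcons ?size_map ?oner_eq0.
Qed.

Lemma spectrum_checkP n (A : 'M[C]_n) l a b x0 xs :
  rep A l -> spectrum_check n l a b x0 xs ->
  spectrum_multiplicities A (nseq (size a).-1 1%N ++ nseq (size b).-1 2%N).
Proof.
move=> Al; rewrite /spectrum_check.
have := horner_tracemP (pmul (map eis_of_Z a) (map eis_of_Z b)) _ Al.
case: horner_tracem => B t BtP /and5P[B0 t0 pxs la /andP[lb /eqP sz_xs]].
set pa := Poly (map (zr R) a); set pb := Poly (map (zr R) b).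
(* The roots are found in the ordered field [R] and then embedded in [C]. *)
have [|rs [sz_rs Urs rts]] := @sign_change_roots R (pa * pb) (zr R x0) (map (zr R) xs).
  rewrite path_map; apply: sub_path pxs => x y /andP[/(zr_lt R) xy /(zr_lt R)].
  by rewrite /= xy !zrM !hornerM !horner_ZE.
have fab : map_poly (real_complex R) (pa * pb)
    = Poly (map phi (pmul (map eis_of_Z a) (map eis_of_Z b))).
  by rewrite rmorphM /= !map_Poly_zr Poly_pmul.
apply: (@spectrum_multiplicities_horner _ _ _
          (map phi (pmul (map eis_of_Z a) (map eis_of_Z b)))
          (map_poly (real_complex R) pa) (map_poly (real_complex R) pb) _ _
          (map (real_complex R) rs)).
- by rewrite -fab rmorphM.
- by rewrite size_map_poly size_Poly_zr.
- by rewrite size_map_poly size_Poly_zr.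
- by rewrite size_map sz_rs size_map.
- rewrite map_inj_uniq; last exact: fmorph_inj.
  exact: (sorted_uniq lt_trans ltxx) (path_sorted Urs).
- rewrite -rmorphM all_map; apply: sub_all rts => x /= rx.
  by rewrite rmorph_root.
- by move=> x; apply: (rep_zero (BtP x).1 B0).
move=> x; rewrite (BtP x).2; congr (_.[x]); apply: subr0_eq.
rewrite -[RHS](Poly_zero t0) Poly_vadd Poly_vscale Poly_vadd Poly_vscale !Poly_pmul.
rewrite !Poly_pderiv -!map_Poly_zr !phi_Z scaleN1r.
by rewrite -[zr _ 2]/(2%:R) scaler_nat.
Qed.

End Representation.

Theorem corollary6p1 (R : realType) (k : 'Z_3) :
  (nu 0 = -1 /\ nu (1 - Mpar%:R) = 1) /\
  (forall sigma : branch,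
     H_Weyl R sigma k \is hermsymmx /\ H_VMY R sigma k \is hermsymmx) /\
  (forall sigma tau : branch,
     ~ unitarily_equivalent (H_Weyl R sigma k) (H_VMY R tau k)) /\
  (forall sigma : branch,
     spectrum_multiplicities (H_Weyl R sigma k) (nseq 8 1%N ++ nseq 8 2%N)) /\
  (forall tau : branch,
     spectrum_multiplicities (H_VMY R tau k) (nseq 12 2%N)).
Proof.
have n8 : 8 != 0 :> R[i] by rewrite pnatr_eq0.
have herm (A : 'M[R[i]]_(2 * 2 * 2 * 3)) : 8 *: A \is hermsymmx -> A \is hermsymmx.
  (* The scalar 8 is fixed by conjugation and can be cancelled. *)
  rewrite !is_hermitianmxE !expr0 !scale1r => /eqP AE; apply/eqP/(scalerI n8).
  rewrite {1}AE linearZ /= map_mxZ; congr (_ *: _); exact: rmorph_nat.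
have W sigma : spectrum_multiplicities (H_Weyl R sigma k) (nseq 8 1%N ++ nseq 8 2%N).
  have /and4P[_ _ Wc _] := check_all sigma k.
  exact: spectrum_multiplicities_scale n8 (spectrum_checkP (rep_H_ring _ _ _ _) Wc).
have V tau : spectrum_multiplicities (H_VMY R tau k) (nseq 12 2%N).
  have /and4P[_ _ _ Vc] := check_all tau k.
  (* The factor a is the constant 1, of degree 0, so the block of simple eigenvalues is empty. *)
  exact: spectrum_multiplicities_scale n8 (spectrum_checkP (rep_H_ring _ _ _ _) Vc).
split; first by [].
split.
  move=> sigma; have /and4P[Wh Vh _ _] := check_all sigma k.
  by split; apply/herm/hermitian_checkP; [exact: rep_H_ring| |exact: rep_H_ring|].
split=> // sigma tau UE.
(* A simple Weyl eigenvalue would force multiplicity 1 into a list consisting of 2 only. *)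
by have /(_ 1%N isT) := unitarily_equivalent_spectrum UE (W sigma) (V tau).
Qed.
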